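(* Let $X$ be a compact metric space and $f_{0,\infty}=\{f_n\}_{n=0}^\infty$ a sequence of continuous self-maps of $X$. Then $(X,f_{0,\infty})$ is exact if and only if $(\mathcal{M}(X),\hat f_{0,\infty})$ is exact.
   Context: Let $(X,d)$ be a compact metric space. A non-autonomous dynamical system $(X,f_{0,\infty})$ is given by a sequence $f_{0,\infty}=\{f_n\}_{n=0}^\infty$ of continuous self-maps of $X$; write $f_0^n=f_{n-1}\circ\cdots\circ f_0$ for $n\ge1$. $\mathcal{M}(X)$ is the space of all Borel probability measures on $X$ with the Prohorov metric $\mathcal{P}_d(\mu,\nu)=\inf\{\epsilon>0:\mu(A)\le\nu(A^\epsilon)+\epsilon \text{ and } \nu(A)\le\mu(A^\epsilon)+\epsilon \text{ for all Borel } A\subset X\}$, where $A^\epsilon=\{x\in X: d(x,A)<\epsilon\}$; its topology is the weak$^*$-topology and $\mathcal{M}(X)$ is a compact metric space. The induced system $(\mathcal{M}(X),\hat f_{0,\infty})$, $\hat f_{0,\infty}=\{\hat f_n\}_{n=0}^\infty$, consists of the continuous maps $\hat f_n(\mu)(A)=\mu(f_n^{-1}(A))$. $(X,f_{0,\infty})$ is (topologically) exact if for every nonempty open $U\subset X$ there is $N_1\ge1$ such that $f_0^n(U)=X$ for all $n\ge N_1$. *)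

(* Defs.v *)
From HB Require Import structures.
From mathcomp Require Import all_boot all_order all_algebra.
From mathcomp Require Import all_classical all_reals all_analysis.

Set Implicit Arguments.
Unset Strict Implicit.
Unset Printing Implicit Defensive.
Import Order.TTheory GRing.Theory Num.Theory.
Import numFieldNormedType.Exports.
Local Open Scope classical_set_scope.
Local Open Scope ring_scope.

(* Measurable types are inhabited by convention in the library, hence so is
   every metric space carrying Borel measures below. *)
#[short(type="pmetricType")]
HB.structure Definition PointedMetric (K : numDomainType) :=
  { T of Pointed T & Metric K T }.

Notation borel X := (g_sigma_algebraType (@open X)).

Section exactness.
Context {T : topologicalType}.
Implicit Type f : nat -> T -> T.

(* [orbit_map f n] is f_{n-1} \o ... \o f_0 *)
Fixpoint orbit_map f (n : nat) : T -> T :=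
  if n is m.+1 then f m \o orbit_map f m else id.

Definition topologically_exact f : Prop :=
  forall U : set T, open U -> U !=set0 ->
    exists2 N : nat, (1 <= N)%N &
      forall n : nat, (N <= n)%N -> orbit_map f n @` U = [set: T].

End exactness.

Section enlargement.
Context {R : realType} {X : metricType R}.
Implicit Type A : set X.

(* The infimum is taken in \bar R so that d(x, set0) = +oo. *)
Definition set_dist (x : X) A : \bar R :=
  ereal_inf [set (mdist x a)%:E | a in A].

Definition enlarge A (e : R) : set X := [set x | (set_dist x A < e%:E)%E].

Lemma enlargeP A e x : enlarge A e x <-> exists2 a, A a & mdist x a < e.
Proof.
split; first by move=> /ereal_inf_lt[_ [a Aa <-]]; rewrite lte_fin; exists a.
move=> [a Aa xa]; rewrite /enlarge /= /set_dist.
apply: (@le_lt_trans _ _ (mdist x a)%:E); last by rewrite lte_fin.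
by apply: ereal_inf_lbound; exists a.
Qed.

Lemma enlarge_open A e : open (enlarge A e).
Proof.
rewrite openE => x /enlargeP[a Aa xa]; apply/nbhs_ballP.
exists (e - mdist x a) => /=; first by rewrite subr_gt0.
move=> y; rewrite ballEmdist /= => xy; apply/enlargeP; exists a => //.
rewrite (le_lt_trans (metric_triangle y x a))// (metric_sym y x).
by rewrite -ltrBrDr.
Qed.

Lemma sub_enlarge A e : 0 < e -> A `<=` enlarge A e.
Proof. by move=> e0 a Aa; apply/enlargeP; exists a; rewrite ?mdistxx. Qed.

Lemma enlarge_le A e e' : e <= e' -> enlarge A e `<=` enlarge A e'.
Proof.
move=> ee' x /enlargeP[a Aa xa]; apply/enlargeP; exists a => //.
exact: lt_le_trans ee'.
Qed.

Lemma enlarge_enlarge A e e' :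
  enlarge (enlarge A e) e' `<=` enlarge A (e + e').
Proof.
move=> x /enlargeP[y /enlargeP[a Aa ya] xy]; apply/enlargeP; exists a => //.
by rewrite (le_lt_trans (metric_triangle x y a))// addrC ltrD.
Qed.

Lemma bigcap_enlarge A : closed A -> \bigcap_n enlarge A n.+1%:R^-1 = A.
Proof.
move=> cA; apply/seteqP; split => [x Ax|a Aa n _]; last first.
  by apply: sub_enlarge Aa; rewrite invr_gt0.
apply: cA => B /nbhs_ballP[e /= e0 xeB].
have [n ne] : exists n, n.+1%:R^-1 < e.
  exists (Num.truncn e^-1); rewrite -[ltRHS]invrK ltf_pV2 ?posrE ?invr_gt0//.
  by rewrite truncnS_gt.
have /enlargeP[a Aa xa] := Ax n I.
by exists a; split=> //; apply: xeB; rewrite ballEmdist /= (lt_trans xa).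
Qed.

End enlargement.

Section borel_probability.
Context (R : realType) (X : pmetricType R).

(* A [probability] of the library is a function on all of [set X], whose values
   outside the sigma-algebra are unconstrained; normalizing them to 0 makes
   equality coincide with equality on Borel sets. *)
Record borel_prob : Type := BorelProb {
  borel_prob_val :> probability (borel X) R ;
  borel_prob_out : forall A : set (borel X), ~ measurable A ->
    borel_prob_val A = 0%E }.

HB.instance Definition _ := gen_eqMixin borel_prob.
HB.instance Definition _ := gen_choiceMixin borel_prob.

Lemma eq_borel_prob (mu nu : borel_prob) :
  (forall A : set (borel X), measurable A -> mu A = nu A) -> mu = nu.
Proof.
move=> E; have {}E : mu = nu :> (set (borel X) -> \bar R).
  apply/funext => A; have [/E//|nA] := pselect (measurable A).
  by rewrite !borel_prob_out.
case: mu nu E => [mu mu0] [nu nu0] /= E.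
have {}E : mu = nu.
  clear mu0 nu0; case: mu nu E => [mu [a1 a2 a3 a4 a5 a6 a7]].
  move=> [nu [b1 b2 b3 b4 b5 b6 b7]] /= E; subst nu.
  destruct a1 as [p1 q1], b1 as [p1' q1'].
  have ? := Prop_irrelevance p1 p1'; have ? := Prop_irrelevance q1 q1'; subst.
  destruct a2 as [p2], a3 as [p3], a4 as [p4], a5 as [p5], a6 as [p6],
    a7 as [p7], b2 as [r2], b3 as [r3], b4 as [r4], b5 as [r5], b6 as [r6],
    b7 as [r7].
  have ? := Prop_irrelevance p2 r2; have ? := Prop_irrelevance p3 r3.
  have ? := Prop_irrelevance p4 r4; have ? := Prop_irrelevance p5 r5.
  have ? := Prop_irrelevance p6 r6; have ? := Prop_irrelevance p7 r7.
  by subst.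
by subst nu; congr BorelProb; exact: Prop_irrelevance.
Qed.

Section normalization.
Variable P : probability (borel X) R.

Definition restrict_borel (A : set (borel X)) : \bar R :=
  if `[< measurable A >] then P A else 0%E.

Lemma restrict_borelE A : measurable A -> restrict_borel A = P A.
Proof. by rewrite /restrict_borel => /asboolT ->. Qed.

Let restrict_borel0 : restrict_borel set0 = 0%E.
Proof. by rewrite restrict_borelE ?measure0. Qed.

Let restrict_borel_ge0 A : (0 <= restrict_borel A)%E.
Proof. by rewrite /restrict_borel; case: ifP. Qed.

Let restrict_borel_sigma_additive : semi_sigma_additive restrict_borel.
Proof.
move=> F mF tF mUF; rewrite restrict_borelE//.
under eq_fun do under eq_bigr do rewrite restrict_borelE//.
exact: measure_semi_sigma_additive.
Qed.

HB.instance Definition _ := isMeasure.Build _ _ _ restrict_borel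
  restrict_borel0 restrict_borel_ge0 restrict_borel_sigma_additive.

Let restrict_borelT : restrict_borel setT = 1%E.
Proof. by rewrite restrict_borelE// probability_setT. Qed.

HB.instance Definition _ :=
  Measure_isProbability.Build _ _ _ restrict_borel restrict_borelT.

Lemma restrict_borel_out A : ~ measurable A -> restrict_borel A = 0%E.
Proof. by rewrite /restrict_borel => /asboolF ->. Qed.

Definition to_borel_prob : borel_prob :=
  @BorelProb restrict_borel restrict_borel_out.

End normalization.

Lemma enlarge_measurable (A : set X) (e : R) :
  measurable (enlarge A e : set (borel X)).
Proof. by apply: sub_sigma_algebra; exact: enlarge_open. Qed.

Definition prohorov_bound (mu nu : borel_prob) (e : R) : Prop :=
  forall A : set (borel X), measurable A ->
    (mu A <= nu (enlarge A e) + e%:E)%E /\ (nu A <= mu (enlarge A e) + e%:E)%E.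

Definition prohorov (mu nu : borel_prob) : R :=
  inf [set e : R | 0 < e /\ prohorov_bound mu nu e].

Implicit Types mu nu rho : borel_prob.

Lemma prohorov_bound_sym mu nu e :
  prohorov_bound mu nu e -> prohorov_bound nu mu e.
Proof. by move=> h A /h[]. Qed.

Lemma prohorov_bound_le mu nu e e' : e <= e' ->
  prohorov_bound mu nu e -> prohorov_bound mu nu e'.
Proof.
move=> ee'; suff h mu1 nu1 A : measurable A ->
    (mu1 A <= nu1 (enlarge A e) + e%:E -> mu1 A <= nu1 (enlarge A e') + e'%:E)%E.
  by move=> b A mA; have [b1 b2] := b A mA; split; [exact: h b1|exact: h b2].
move=> mA /le_trans; apply; apply: leeD; rewrite ?lee_fin//.
apply: le_measure; rewrite ?inE; try exact: enlarge_measurable.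
exact: enlarge_le.
Qed.

Lemma prohorov_bound1 mu nu : prohorov_bound mu nu 1.
Proof.
move=> A mA; split; (apply: le_trans (probability_le1 _ mA) _);
  by rewrite leeDr// measure_ge0.
Qed.

Lemma prohorov_bound_refl mu e : 0 < e -> prohorov_bound mu mu e.
Proof.
move=> e0 A mA; suff : (mu A <= mu (enlarge A e) + e%:E)%E by [].
apply: (@le_trans _ _ (mu (enlarge A e))); last by rewrite leeDl// lee_fin ltW.
by apply: le_measure; rewrite ?inE//;
  [exact: enlarge_measurable|exact: sub_enlarge].
Qed.

Lemma prohorov_bound_trans mu nu rho e e' :
  prohorov_bound mu nu e -> prohorov_bound nu rho e' ->
  prohorov_bound mu rho (e + e').
Proof.
suff h mu1 nu1 rho1 e1 e1' : prohorov_bound mu1 nu1 e1 ->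
    prohorov_bound nu1 rho1 e1' -> forall A : set (borel X), measurable A ->
    (mu1 A <= rho1 (enlarge A (e1 + e1')) + (e1 + e1')%:E)%E.
  move=> b b' A mA; split; first exact: (h _ _ _ _ _ b b' _ mA).
  rewrite [(e + e')%R]addrC.
  exact: (h _ _ _ _ _ (prohorov_bound_sym b') (prohorov_bound_sym b) _ mA).
move=> b b' A mA; apply: le_trans (b A mA).1 _.
apply: le_trans (leeD2r _ (b' _ (enlarge_measurable A e1)).1) _.
rewrite EFinD [(e1%:E + _)%E]addeC addeA.
do 2 apply: leeD2r; apply: le_measure; rewrite ?inE;
  try exact: enlarge_measurable.
exact: enlarge_enlarge.
Qed.

Lemma prohorov_has_inf mu nu :
  has_inf [set e : R | 0 < e /\ prohorov_bound mu nu e].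
Proof.
split; first by exists 1; split=> //; exact: prohorov_bound1.
by exists 0 => e [/ltW].
Qed.

Lemma prohorov_ge0 mu nu : 0 <= prohorov mu nu.
Proof.
apply: lb_le_inf; first exact: (prohorov_has_inf mu nu).1.
by move=> e [/ltW].
Qed.

Lemma prohorov_le mu nu e : 0 < e -> prohorov_bound mu nu e ->
  prohorov mu nu <= e.
Proof. by move=> e0 b; apply: ge_inf => //; exact: (prohorov_has_inf mu nu).2. Qed.

Lemma prohorov_lt mu nu e : prohorov mu nu < e -> prohorov_bound mu nu e.
Proof.
move/(inf_lt (prohorov_has_inf mu nu).1) => [e' [_ b] /ltW e'e].
exact: prohorov_bound_le b.
Qed.

Let prohorovxx mu : prohorov mu mu = 0.
Proof.
apply/eqP; rewrite eq_le prohorov_ge0 andbT; apply/ler_addgt0Pl => e e0.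
by rewrite addr0; apply: prohorov_le => //; exact: prohorov_bound_refl.
Qed.

Let prohorov_sym mu nu : prohorov mu nu = prohorov nu mu.
Proof.
rewrite /prohorov; congr inf; apply/seteqP.
by split=> e [e0 /prohorov_bound_sym].
Qed.

Let prohorov_triangle nu mu rho :
  prohorov mu rho <= prohorov mu nu + prohorov nu rho.
Proof.
apply/ler_addgt0Pr => e e0; have e20 : 0 < e / 2 by rewrite divr_gt0.
rewrite [e]splitr addrACA; apply: prohorov_le.
  by rewrite addr_gt0// ltr_wpDl// prohorov_ge0.
by apply: (@prohorov_bound_trans _ nu); apply: prohorov_lt; rewrite ltrDl.
Qed.

Lemma prohorov_eq0_closed mu nu (A : set X) : closed A ->
  prohorov mu nu = 0 -> (mu A <= nu A)%E.
Proof.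
move=> cA d0; have mA : measurable (A : set (borel X)).
  rewrite -[A]setCK; apply: measurableC; apply: sub_sigma_algebra.
  exact: closed_openC.
have cvg_nu : (nu (enlarge A n.+1%:R^-1) + (n.+1%:R^-1)%:E)%E @[n --> \oo] -->
    (nu A + 0)%E.
  apply: cvgeD; first by rewrite fin_num_adde_defl.
    rewrite -{2}(bigcap_enlarge cA).
    apply: (@nonincreasing_cvg_mu _ (borel X) R nu) => //.
    - by rewrite (le_lt_trans (probability_le1 _ (enlarge_measurable _ _)))// ltry.
    - by move=> n; exact: enlarge_measurable.
    - by apply: bigcapT_measurable => n; exact: enlarge_measurable.
    - move=> m n mn; apply/subsetPset; apply: enlarge_le.
      by rewrite lef_pV2 ?posrE// ler_nat.
  by apply: cvg_EFin; [exact: nearW|exact: cvg_harmonic].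
rewrite -[leRHS]adde0; apply: cvge_ge cvg_nu; apply: nearW => n.
have n0 : 0 < n.+1%:R^-1 :> R by rewrite invr_gt0.
have b : prohorov_bound mu nu n.+1%:R^-1 by apply: prohorov_lt; rewrite d0.
exact: (b _ mA).1.
Qed.

Let prohorov_positivity mu nu : prohorov mu nu = 0 -> mu = nu.
Proof.
move=> d0; apply: eq_borel_prob.
apply: (@g_sigma_algebra_measure_unique _ R (borel X) open _ (fun=> setT)).
- by move=> A; exact: sub_sigma_algebra.
- by move=> _; exact: openT.
- by apply/seteqP; split=> // x _; exists 0%N.
- exact: openI.
- move=> U oU; have cU : closed (~` U) by exact: open_closedC.
  have mU : measurable (U : set (borel X)) by exact: sub_sigma_algebra.
  have mCU : measurable (~` U : set (borel X)) by exact: measurableC.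
  suff E : mu (~` U) = nu (~` U).
    have := probability_setC mu mCU; have := probability_setC nu mCU.
    by rewrite E !setCK => <-.
  apply/eqP; rewrite eq_le !prohorov_eq0_closed//.
  by rewrite prohorov_sym.
- by move=> _; apply: le_lt_trans (ltry 1); exact: probability_le1.
Qed.

HB.instance Definition _ := isMetric.Build R borel_prob
  prohorovxx prohorov_positivity prohorov_sym prohorov_triangle.

End borel_probability.

Section induced.
Context (R : realType) (X : pmetricType R).
Variable f : continuousType X X.

Lemma continuous_borel : measurable_fun [set: borel X] (f : borel X -> borel X).
Proof.
apply: (@measurability _ _ (borel X) (borel X) setT f (@open X)) => // _ [U oU <-]; rewrite setTI.
apply: sub_sigma_algebra; apply: open_comp oU => x _; exact: cts_fun.
Qed.

HB.instance Definition _ := isMeasurableFun.Build _ _ (borel X) (borel X)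
  (f : borel X -> borel X) continuous_borel.

Definition induced_map (mu : borel_prob X) : borel_prob X :=
  to_borel_prob (distribution mu f).

Lemma induced_mapE mu (A : set (borel X)) : measurable A ->
  induced_map mu A = mu (f @^-1` A).
Proof. exact: restrict_borelE. Qed.

End induced.

(* Main.v *)
(**
A continuous surjection g of a closed subset K of a compact metric space onto X
has a Borel section s: list countably many closed sets that separate points,
and for each x shrink the fibre of g over x greedily, intersecting it with each
closed set in turn whenever the intersection is nonempty; a single point
remains, and the set of x whose shrunken fibre meets a closed set is Borel at
each stage.

If (X, f) is exact, cover X by finitely many small open sets V_0, ..., V_(m-1);
for n large, g = f_0^n maps each V_k onto X and so has a Borel section s_k with
values in the closure of V_k.  Let i(x) be the first index with x in V_(i(x)).
The image of mu x nu under T(x, y) = s_(i(x))(y) is Prohorov-close to mu,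
because T(x, y) is close to x, and is mapped by g to nu, because g(T(x, y)) = y.

Conversely, if g maps a measure close to the Dirac mass at x to the Dirac mass
at y, then that measure is carried by the fibre over y and charges a small ball
around x, so g(z) = y for some z near x.
*)
Require Import Defs.
From mathcomp Require Import all_boot all_order all_algebra finmap.
From mathcomp Require Import all_classical all_reals all_analysis.
Import Order.TTheory GRing.Theory Num.Theory.
Import numFieldNormedType.Exports.
Local Open Scope classical_set_scope.

(** * Compactness, separating families and Borel sets *)

Lemma compact_bigcap_nonincreasing {T : ptopologicalType} (D : nat -> set T) :
  compact [set: T] -> (forall k, closed (D k)) ->
  (forall k, D k.+1 `<=` D k) -> (forall k, D k !=set0) ->
  \bigcap_k D k !=set0.
Proof.
move=> cT clD decrD D0.
have mono : forall i j, (i <= j)%N -> D j `<=` D i.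
  move=> i j /subnK <-; elim: (j - i)%N => [//|m IH].
  by apply: subset_trans IH; rewrite addSn; exact: decrD.
move: cT; rewrite compact_In0 => /(_ nat [set: nat] D); apply.
  by exists D => // i _; rewrite setTI.
(* The sets decrease, so a point of the one with the largest index in [E] lies in all of them. *)
move=> E _; have [x Dx] := D0 (\max_(i <- enum_fset E) i)%N.
exists x => i /= iE; apply: mono Dx.
exact: (@leq_bigmax_seq _ _ xpredT id).
Qed.

Lemma hausdorff_countable_separating {T : topologicalType} :
  hausdorff_space T -> @second_countable T ->
  exists C : nat -> set T, (forall k, closed (C k)) /\
    forall y z, y <> z -> exists2 k, C k y & ~ C k z.
Proof.
move=> hT [B /countable_injP[f finj] [oB basisB]].
(* By injectivity of [f] on [B], this intersection has at most one term, the complement of the basic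
   open set coded by [k]; it is the whole space when [k] codes none. *)
exists (fun k => \bigcap_(U in [set U | B U /\ f U = k]) ~` U); split.
  by move=> k; apply: closed_bigI => U [/oB oU _]; exact: open_closedC.
move=> y z yz.
have cy : nbhs z (~` [set y]).
  apply: open_nbhs_nbhs; split; last by move=> /= zy; apply: yz.
  apply: closed_openC; apply: accessible_closed_set1.
  exact: hausdorff_accessible.
have [U [BU Uz] Uy] := basisB z _ cy.
exists (f U) => [V [BV]|Cz]; last exact: (Cz U).
by move/finj; rewrite !inE => -> // Vy; exact: Uy Vy _.
Qed.

Lemma closed_borel_measurable {T : ptopologicalType} (F : set T) :
  closed F -> measurable (F : set (borel T)).
Proof.
move=> clF; rewrite -[F]setCK; apply: measurableC; apply: sub_sigma_algebra.
exact: closed_openC.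
Qed.

Lemma continuous_borel_measurable {S T : ptopologicalType} (g : S -> T) :
  continuous g -> measurable_fun setT (g : borel S -> borel T).
Proof.
move=> ctsg.
apply: (@measurability _ _ (borel S) (borel T) setT g (@open T)) => // _ [U oU <-].
rewrite setTI; apply: sub_sigma_algebra; apply: open_comp oU => x _.
exact: ctsg.
Qed.

(** * Borel choice functions *)

Section narrowing.
Context {T : ptopologicalType}.
Variable C : nat -> set T.

(* The lexicographically least choice of a point: its membership in [C 0],
   [C 1], ... is decided greedily. *)
Fixpoint narrow (A : set T) (k : nat) : set T :=
  if k is k'.+1 then
    if `[< narrow A k' `&` C k' !=set0 >] then narrow A k' `&` C k'
    else narrow A k'
  else A.

Lemma narrow_decr A k : narrow A k.+1 `<=` narrow A k.
Proof. by move=> x /=; case: asboolP => // _ []. Qed.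

Lemma narrow_nonempty A k : A !=set0 -> narrow A k !=set0.
Proof. by move=> A0; elim: k => //= k IH; case: asboolP. Qed.

Lemma closed_narrow A k : (forall i, closed (C i)) -> closed A ->
  closed (narrow A k).
Proof.
move=> clC clA; elim: k => //= k IH; case: asboolP => // _; exact: closedI.
Qed.

(** If [C k] contained [x] but not [y], then [x], lying in every stage, would make stage [k] meet
    [C k]; stage [k.+1] would then be cut down to [C k] and lose [y]. *)
Lemma narrow_separates A x y :
  (forall y z, y <> z -> exists2 k, C k y & ~ C k z) ->
  (\bigcap_k narrow A k) x -> (\bigcap_k narrow A k) y -> x = y.
Proof.
move=> sepC Ax Ay; apply: contrapT => /sepC[k Cx Cy].
have := Ay k.+1 I => /=; case: asboolP => [_ [_ /Cy]//|].
by move=> + _; apply; exists x; split=> //; exact: Ax.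
Qed.

End narrowing.

Lemma measurable_selection {S T : ptopologicalType} (g : T -> S) (K : set T) :
  compact [set: T] -> hausdorff_space T -> @second_countable T ->
  hausdorff_space S -> continuous g -> closed K -> g @` K = [set: S] ->
  exists2 s : S -> T, measurable_fun [set: borel S] (s : borel S -> borel T) &
    forall x, K (s x) /\ g (s x) = x.
Proof.
move=> cT hT scT hS ctsg clK gK.
have [C [clC sepC]] := hausdorff_countable_separating hT scT.
pose N x k := narrow C (K `&` g @^-1` [set x]) k.
have clN x k : closed (N x k).
  apply: closed_narrow => //; apply: closedI => //.
  apply: closed_comp => [y _|]; first exact: ctsg.
  by apply: accessible_closed_set1; exact: hausdorff_accessible.
have N0 x k : N x k !=set0.
  apply: narrow_nonempty; have : [set: S] x by [].
  by rewrite -gK => -[y Ky gy]; exists y.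
(* The induction is uniform in [F], since its step replaces [F] by [C k] and by [C k] intersected
   with [F]. At stage 0 the set is the image under [g] of a compact set, hence closed. *)
have mhit k : forall F : set T, closed F ->
    measurable ([set x | N x k `&` F !=set0] : set (borel S)).
  elim: k => [|k IH] F clF.
    rewrite [X in measurable X](_ : _ = g @` (K `&` F)); last first.
      apply/seteqP; split=> [x [y [[Ky gy] Fy]]|x [y [Ky Fy] gy]].
        by exists y.
      by exists y.
    apply: closed_borel_measurable; apply: compact_closed => //.
    apply: continuous_compact; first exact: continuous_subspaceT.
    by apply: subclosed_compact cT _ => //; exact: closedI.
  (* Either the fibre was cut by [C k] and the cut part meets [F], or it missed [C k] and was left
     unchanged. *)
  rewrite [X in measurable X](_ : _ =
      [set x | N x k `&` (C k `&` F) !=set0] `|`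
      ([set x | N x k `&` F !=set0] `\` [set x | N x k `&` C k !=set0])).
    by apply: measurableU; [|apply: measurableD]; apply: IH => //; exact: closedI.
  have NS x : N x k.+1 = if `[< N x k `&` C k !=set0 >] then N x k `&` C k
                         else N x k by [].
  apply/seteqP; split=> x /=; rewrite NS setIA; case: asboolP => h.
  - by left.
  - by right.
  - by case=> // -[].
  - by case=> [[y [Hy _]]|[]//]; exfalso; apply: h; exists y.
(* Compactness passes from all finite stages to the limit fibre. *)
have nonempty_cap x F : closed F -> (forall k, N x k `&` F !=set0) ->
    exists2 y, (\bigcap_k N x k) y & F y.
  move=> clF hitF.
  have [|k y [Ny Fy]||y NFy] :=
      @compact_bigcap_nonincreasing T (fun k => N x k `&` F) cT.
  - by move=> k; exact: closedI (clN x k) clF.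
  - by split=> //; exact: narrow_decr Ny.
  - by [].
  - by exists y => [k _|]; [have [] := NFy k I | have [] := NFy 0%N I].
have /choice[s sN] : forall x, exists y, (\bigcap_k N x k) y.
  by move=> x; have [|k|y] := nonempty_cap x setT; rewrite ?setIT //; exists y.
exists s; last by move=> x; have [? ?] := sN x 0%N I.
have s_preimage F : closed F -> measurable (s @^-1` F : set (borel S)).
  move=> clF; rewrite (_ : s @^-1` F = \bigcap_k [set x | N x k `&` F !=set0]).
    by apply: bigcapT_measurable => k; exact: mhit.
  apply/seteqP; split=> x /= Fx; first by move=> k _; exists (s x); split=> //; exact: sN.
  have [|k|y Ny Fy] := nonempty_cap x F => //; first exact: Fx.
  by rewrite (narrow_separates _ _ _ _ sepC (sN x) Ny).
apply: (@measurability _ _ (borel S) (borel T) setT s (@open T)) => // _ [U oU <-].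
rewrite setTI -(setCK U) preimage_setC.
by apply: measurableC; exact: s_preimage (open_closedC oU).
Qed.

Lemma measurable_first_index {d} {T : measurableType d} (V : nat -> set T)
    (m : nat) :
  (forall k, measurable (V k)) ->
  (forall x, exists2 k, (k < m)%N & V k x) ->
  exists2 i : T -> nat, (forall x, (i x < m)%N /\ V (i x) x) &
    forall k, measurable [set x | i x = k].
Proof.
move=> mV covV.
have /choice[i iP] : forall x, exists k, V k x /\ forall j, V j x -> (k <= j)%N.
  move=> x; have ex : exists k, `[< V k x >].
    by have [k _ Vk] := covV x; exists k; exact/asboolP.
  case: (ex_minnP ex) => k /asboolP Vk kmin; exists k; split=> // j Vj.
  by apply: kmin; exact/asboolP.
exists i => [x|k].
  have [Vi imin] := iP x; split=> //; have [k km Vk] := covV x.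
  exact: leq_ltn_trans (imin _ Vk) km.
rewrite (_ : [set x | _] = V k `\` \bigcup_(j < k) V j).
  by apply: measurableD => //; exact: bigcup_measurable.
apply/seteqP; split=> x /=.
  by move=> <-; have [Vi imin] := iP x; split=> // -[j /= ji /imin]; rewrite leqNgt ji.
move=> [Vk nV]; have [Vi imin] := iP x; apply/eqP; rewrite eqn_leq imin//=.
by rewrite leqNgt; apply/negP => ik; apply: nV; exists (i x).
Qed.

(** * Iterates of the system and of the induced system *)

Section orbit_maps.
Context {R : realType} {X : pmetricType R}.
Variable f : nat -> continuousType X X.

Lemma continuous_orbit_map n : continuous (orbit_map (fun n => (f n : X -> X)) n).
Proof.
elim: n => [|n IH] x; first exact: cvg_id.
by apply: continuous_comp; [exact: IH|exact: cts_fun].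
Qed.

Lemma orbit_map_inducedE n (mu : borel_prob X) (A : set (borel X)) :
  measurable A ->
  orbit_map (fun n => induced_map (f n) : borel_prob X -> borel_prob X) n mu A =
  mu (orbit_map (fun n => (f n : X -> X)) n @^-1` A).
Proof.
elim: n A => [//|n IH] A mA /=; rewrite induced_mapE// IH//.
by rewrite -[_ @^-1` A]setTI; exact: continuous_borel.
Qed.

End orbit_maps.

(** * Couplings, Prohorov neighbourhoods and small covers *)

Section prohorov_topology.
Context {R : realType} {X : pmetricType R}.
Local Open Scope ring_scope.
Implicit Types mu nu : borel_prob X.

(** Whenever [Y] falls in [A], [Z] falls in the enlargement of [A], and symmetrically; monotonicity
    of [P] gives both inequalities. *)
Lemma prohorov_bound_coupling {d} {Omega : measurableType d}
    (P : probability Omega R) (Y Z : Omega -> borel X) mu nu (e : R) :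
  measurable_fun setT Y -> measurable_fun setT Z -> 0 <= e ->
  (forall A : set (borel X), measurable A -> mu A = P (Y @^-1` A)) ->
  (forall A : set (borel X), measurable A -> nu A = P (Z @^-1` A)) ->
  (forall w, mdist (Y w : X) (Z w) < e) ->
  prohorov_bound mu nu e.
Proof.
move=> mY mZ e0 muE nuE YZ.
have meas (W : Omega -> borel X) (A : set (borel X)) :
    measurable_fun setT W -> measurable A -> measurable (W @^-1` A).
  by move=> mW mA; rewrite -[_ @^-1` A]setTI; exact: mW.
move=> A mA; rewrite !muE ?nuE//; try exact: enlarge_measurable.
have mE := enlarge_measurable A e.
split.
  apply: (@le_trans _ _ (P (Z @^-1` enlarge A e))); last first.
    by rewrite leeDl// lee_fin.
  apply: le_measure; rewrite ?inE; [exact: meas|exact: meas|].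
  by move=> w /= Aw; apply/enlargeP; exists (Y w) => //; rewrite metric_sym.
apply: (@le_trans _ _ (P (Y @^-1` enlarge A e))); last first.
  by rewrite leeDl// lee_fin.
apply: le_measure; rewrite ?inE; [exact: meas|exact: meas|].
by move=> w /= Aw; apply/enlargeP; exists (Z w).
Qed.

Lemma nbhs_prohorovP mu (U : set (borel_prob X)) : nbhs mu U ->
  exists2 e : R, 0 < e & forall nu, prohorov mu nu < e -> U nu.
Proof.
by move=> /nbhs_ballP[e /= e0 eU]; exists e.
Qed.

Lemma closure_sub_enlarge (A : set X) (e : R) : 0 < e ->
  closure A `<=` enlarge A e.
Proof.
move=> e0 x Ax; have [y [Ay]] := Ax _ (nbhsx_ballx x _ e0).
by rewrite ballEmdist /= => xy; apply/enlargeP; exists y.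
Qed.

Lemma compact_small_cover (e : R) : compact [set: X] -> 0 < e ->
  exists (m : nat) (V : nat -> set X),
    [/\ forall k, open (V k), forall k, V k !=set0,
        forall k x y, closure (V k) x -> closure (V k) y -> mdist x y < e &
        forall x, exists2 k, (k < m)%N & V k x].
Proof.
rewrite compact_cover => cX e0.
(* Passing to the closure costs a second [e / 4], which leaves points within [e / 2] of the centre
   and within [e] of each other. *)
have d0 : 0 < e / 2 / 2 by rewrite !divr_gt0.
have [||D _ Dcov] := cX X setT (fun x => enlarge [set x] (e / 2 / 2)).
- by move=> x _; exact: enlarge_open.
- by move=> x _; exists x => //; exact: sub_enlarge.
exists (size (enum_fset D)).
(* Past the end of the list the centre defaults to [point], so openness, nonemptiness and smallness
   hold for every [k]. *)
exists (fun k => enlarge [set nth point (enum_fset D) k] (e / 2 / 2)); split.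
- by move=> k; exact: enlarge_open.
- by move=> k; exists (nth point (enum_fset D) k); exact: sub_enlarge.
- move=> k x y; set c := nth _ _ _ => cx cy.
  have near_c z : closure (enlarge [set c] (e / 2 / 2)) z -> mdist z c < e / 2.
    move=> /(closure_sub_enlarge _ _ d0)/enlarge_enlarge; rewrite -splitr.
    by move=> /enlargeP[_ ->].
  rewrite (le_lt_trans (metric_triangle x c y))// [ltRHS]splitr ltrD ?near_c//.
  by rewrite metric_sym near_c.
- move=> x; have [c /= cD cx] := Dcov x I.
  exists (index c (enum_fset D)); first by rewrite index_mem.
  by rewrite nth_index.
Qed.

End prohorov_topology.

(** * Lifting a measure through a locally onto map *)

Section lifting.
Context {R : realType} {X : pmetricType R}.
Local Open Scope ring_scope.
Implicit Types mu nu : borel_prob X.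

Definition dirac_borel (x : X) : borel_prob X :=
  to_borel_prob (\d_(x : borel X) : probability (borel X) R).

Lemma dirac_borelE (x : X) (A : set (borel X)) :
  measurable A -> dirac_borel x A = (\1_A x)%:E.
Proof. by move=> mA; rewrite [LHS]restrict_borelE. Qed.

Definition image_borel {d} {Omega : measurableType d}
  (P : probability Omega R) (T : {mfun Omega >-> borel X}) : borel_prob X :=
  to_borel_prob (distribution P T).

Lemma prohorov_near_lift (g : X -> X) (e : R) (m : nat) (V : nat -> set X) mu nu :
  compact [set: X] -> continuous g -> 0 < e ->
  (forall k, open (V k)) ->
  (forall k x y, closure (V k) x -> closure (V k) y -> mdist x y < e) ->
  (forall x, exists2 k, (k < m)%N & V k x) ->
  (forall k, (k < m)%N -> g @` V k = [set: X]) ->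
  exists rho : borel_prob X, prohorov_bound mu rho e /\
    forall A : set (borel X), measurable A -> rho (g @^-1` A) = nu A.
Proof.
move=> cX ctsg e0 oV diamV covV gV.
have hX : hausdorff_space X := @metric_hausdorff R X.
have mV k : measurable (V k : set (borel X)) by exact: sub_sigma_algebra.
have [i iV mi] := @measurable_first_index _ (borel X) V m mV covV.
have /choice[s sP] : forall k, exists s : X -> X,
    measurable_fun setT (s : borel X -> borel X) /\
    ((k < m)%N -> forall y, closure (V k) (s y) /\ g (s y) = y).
  (* For [k] at least [m] the identity is a placeholder: the index [i] takes values below [m].
     Closures appear because the selection is made from a closed set. *)
  move=> k; have [km|_] := ltnP k m; last by exists id; split=> //; exact: measurable_id.
  have [||s ms sP] := measurable_selection g (closure (V k)) cX hX
    (compact_second_countable cX) hX ctsg.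
  - exact: closed_closure.
  - apply/seteqP; split=> // y _; have [x Vx <-] : (g @` V k) y by rewrite gV.
    by exists x => //; exact: subset_closure.
  - by exists s.
pose T (p : borel X * borel X) : borel X := s (i p.1) p.2.
have mT : measurable_fun setT T.
  move=> _ A mA; rewrite setTI.
  (* Slicing by the value of [i] gives countably many measurable rectangles. *)
  rewrite (_ : T @^-1` A = \bigcup_k ([set x | i x = k] `*` s k @^-1` A)).
    apply: bigcupT_measurable => k; apply: measurableX => //.
    by rewrite -[_ @^-1` A]setTI; exact: (sP k).1.
  apply/seteqP; split=> -[x y] /=; first by exists (i x).
  by move=> [k _ [/= <-]].
have T_in_V p : closure (V (i p.1)) (T p) /\ g (T p) = p.2.
  exact: (sP _).2 (iV _).1 _.
pose P : probability _ R := (mu \x nu)%E.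
exists (image_borel P (mfun_Sub (mem_set mT))).
have P1 (A : set (borel X)) : measurable A -> P (fst @^-1` A) = mu A.
  move=> mA; rewrite (_ : fst @^-1` A = A `*` setT); last first.
    by apply/seteqP; split=> -[x y] //= [].
  transitivity (mu A * nu setT)%E; first exact: product_measure1E.
  by rewrite probability_setT mule1.
have P2 (A : set (borel X)) : measurable A -> P (snd @^-1` A) = nu A.
  move=> mA; rewrite (_ : snd @^-1` A = setT `*` A); last first.
    by apply/seteqP; split=> -[x y] //= [].
  transitivity (mu setT * nu A)%E; first exact: product_measure1E.
  by rewrite probability_setT mul1e.
have mg (A : set (borel X)) : measurable A -> measurable (g @^-1` A : set (borel X)).
  by move=> mA; rewrite -[_ @^-1` A]setTI; exact: continuous_borel_measurable.
split.
  (* The first coordinate and its image under [T] lie in the closure of the same [V k]. *)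
  apply: (prohorov_bound_coupling P fst T) => //.
  - exact: ltW.
  - by move=> A mA; rewrite P1.
  - by move=> A mA; rewrite [LHS]restrict_borelE.
  - move=> p; apply: (diamV (i p.1)) (T_in_V p).1.
    exact/subset_closure/(iV _).2.
move=> A mA; rewrite [LHS]restrict_borelE; last exact: mg.
rewrite -P2// /distribution /pushforward; congr (P _).
by apply/seteqP; split=> p /=; rewrite (T_in_V p).2.
Qed.

End lifting.

(** * Equivalence of the two exactness properties *)

Theorem theorem2p12 (R : realType) (X : pmetricType R)
    (f : nat -> continuousType X X) :
  compact [set: X] ->
  topologically_exact (fun n => (f n : X -> X)) <->
  topologically_exact (fun n => induced_map (f n) : borel_prob X -> borel_prob X).
Proof.
move=> cX; set F := fun n => (f n : X -> X).
split=> [exF U oU [mu Umu]|exM U oU [x Ux]].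
  have [e e0 eU] := nbhs_prohorovP _ _ (open_nbhs_nbhs (conj oU Umu)).
  (* A bound at [e / 2] yields only a non-strict inequality for the distance; halving makes it
     strictly less than [e]. *)
  have e20 : (0 < e / 2)%R by rewrite divr_gt0.
  have [m [V [oV V0 diamV covV]]] := compact_small_cover _ cX e20.
  have /choice[N NP] : forall k, exists N : nat, forall n, (N <= n)%N ->
      orbit_map F n @` V k = [set: X].
    by move=> k; have [N _ NP] := exF _ (oV k) (V0 k); exists N.
  (* The successor guarantees a threshold of at least 1. *)
  exists (\max_(k < m) N k).+1%N => // n Nn; apply/seteqP; split=> // nu _.
  have [|rho [near_rho rhoE]] := prohorov_near_lift (orbit_map F n) _ _ _ mu nu cX
      (continuous_orbit_map f n) e20 oV diamV covV.
    move=> k km; apply: NP; apply: leq_trans (ltnW Nn).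
    exact: (leq_bigmax (Ordinal km)).
  exists rho.
    apply: eU; apply: le_lt_trans (prohorov_le e20 near_rho) _.
    by rewrite ltr_pdivrMr// ltr_pMr// ltr1n.
  by apply: eq_borel_prob => A mA; rewrite orbit_map_inducedE// rhoE.
have [e /= e0 eU] : exists2 e : R, (0 < e)%R & ball x e `<=` U.
  by apply/nbhs_ballP; exact: open_nbhs_nbhs.
(* Being at most [e] keeps the enlargement of the point [x] inside [U]; being below 1 makes the
   final inequality absurd. *)
pose e' := Num.min e (1 / 2)%R.
have e'0 : (0 < e')%R by rewrite lt_min e0 divr_gt0.
have e'1 : (e' < 1)%R.
  by rewrite gt_min; apply/orP; right; rewrite ltr_pdivrMr// mul1r ltr1n.
have [||N N1 NP] := exM (ball (dirac_borel x) e')°.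
- exact: open_interior.
- by exists (dirac_borel x); exact: nbhsx_ballx.
exists N => // n /NP exn; apply/seteqP; split=> // y _.
have : [set: borel_prob X] (dirac_borel y) by [].
rewrite -exn => -[mu mux muy]; have {}mux := interior_subset mux.
rewrite ballEmdist /= in mux; have {}mux := prohorov_lt mux.
have m1 (z : X) : measurable ([set z] : set (borel X)).
  apply: closed_borel_measurable; apply: accessible_closed_set1.
  exact/hausdorff_accessible/metric_hausdorff.
pose G := orbit_map F n @^-1` [set y].
have mG : measurable (G : set (borel X)).
  rewrite -[G]setTI; apply: continuous_borel_measurable => //.
  exact: continuous_orbit_map.
have muG : mu G = 1%E.
  by rewrite -orbit_map_inducedE// muy dirac_borelE// indicE mem_set.
(* If [y] is missed, the fibre [G], of full measure, avoids the enlargement of [x], which is then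
   [mu]-null. The Prohorov bound on the singleton of [x] becomes 1 at most [e']. *)
apply: contrapT => nUy.
have : (mu (enlarge [set x] e') <= mu (~` G))%E.
  apply: le_measure; rewrite ?inE; [exact: enlarge_measurable|exact: measurableC|].
  move=> z /enlargeP[_ -> zx] Gz; apply: nUy; exists z => //; apply: eU.
  by rewrite ballEmdist /= metric_sym (lt_le_trans zx)// ge_min lexx.
rewrite probability_setC// muG subee// => mu0.
have := (mux _ (m1 x)).1; rewrite dirac_borelE// indicE mem_set//=.
move=> /le_trans/(_ (leeD2r _ mu0)); rewrite add0e lee_fin.
by rewrite leNgt e'1.
Qed.
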